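(* Let $A$ be an $n\times n$ nonnegative matrix such that $\operatorname{per}(A)=\det(A)$ and $A_{ii}\neq 0$ for all $i\in[n]$. Let $e$ denote the identity element of $S_n$. Then the following statements are equivalent: (1) $\operatorname{per}(A^k)=\det(A^k)$ for all $k\in\mathbb{N}$; (2) $\operatorname{per}(A^2)=\det(A^2)$; (3) $\operatorname{per}(A)=L_e(A)$; (4) $\operatorname{per}(A^k)=L_e(A^k)$ for all $k\in\mathbb{N}$.
   Context: $[n]=\{1,\dots,n\}$ and $\mathbb{N}$ is the set of positive integers. A nonnegative matrix is a matrix whose entries are all nonnegative real numbers; $A_{ij}$ is its $(i,j)$-entry. $\operatorname{per}(A)=\sum_{\sigma\in S_n}\prod_{i=1}^n A_{i\sigma(i)}$ is the permanent, and $L_\sigma(A)=\prod_{i=1}^n A_{i\sigma(i)}$ for $\sigma\in S_n$; in particular $L_e(A)=\prod_{i=1}^n A_{ii}$. *)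

(* Defs.v *)
From HB Require Import structures.
From mathcomp Require Import all_boot all_order all_fingroup all_algebra.
From mathcomp Require Import reals.

Set Implicit Arguments.
Unset Strict Implicit.
Unset Printing Implicit Defensive.

Import Order.TTheory GRing.Theory Num.Theory.
Local Open Scope ring_scope.

Definition permprod (R : comPzRingType) (n : nat) (s : 'S_n) (A : 'M[R]_n) : R :=
  \prod_(i < n) A i (s i).

Definition permanent (R : comPzRingType) (n : nat) (A : 'M[R]_n) : R :=
  \sum_(s : 'S_n) permprod s A.

(* Main.v *)
(** For a nonnegative matrix, [per B = det B] says that no odd permutation is
    supported by the nonzero entries of [B], and [per B = L_e B] that the
    identity is the only one that can be.
    - If [A] supports an even [s] with [s i != i], then [A^2] supports the odd
      permutation that agrees with [s] except that [i] goes to [s (s i)] and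
      [s i] is fixed: the edges are walks of length two, padded by loops. Hence
      (2) implies (3).
    - If [A] supports only the identity, its digraph has no cycle other than
      loops. Entries of [A^k] are weights of walks, so a permutation supported
      by [A^k] moves each point along a walk of [A]; following the permutation
      around its orbit closes this walk, so the point is fixed. Hence (3)
      implies (4). *)
Require Import Defs.
From HB Require Import structures.
From mathcomp Require Import all_boot all_order all_fingroup all_algebra.
From mathcomp Require Import reals.

Set Implicit Arguments.
Unset Strict Implicit.
Unset Printing Implicit Defensive.

Import Order.TTheory GRing.Theory Num.Theory.
Local Open Scope ring_scope.

Section NonnegativePermanent.
Variables (R : numDomainType) (n : nat).
Implicit Types (A B : 'M[R]_n) (s : 'S_n).

Lemma permprod_ge0 A s : (forall i j, 0 <= A i j) -> 0 <= permprod s A.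
Proof. by move=> A_ge0; apply: prodr_ge0. Qed.

Lemma permprod_neq0P A s :
  reflect (forall i, A i (s i) != 0) (permprod s A != 0).
Proof.
apply: (iffP (prodf_neq0 _ _)) => [nz i | nz i _]; exact: nz.
Qed.

(** In [permanent A - \det A] an even permutation contributes 0 and an odd one twice its nonnegative
    product, so if the difference vanishes, each term does. *)
Lemma permprod_odd_eq0 A s : (forall i j, 0 <= A i j) ->
  permanent A = \det A -> odd_perm s -> permprod s A = 0.
Proof.
move=> A_ge0 /eqP; rewrite -subr_eq0 /permanent /determinant -sumrB => per_det s_odd.
have summand_ge0 (t : 'S_n) : true ->
    0 <= permprod t A - (-1) ^+ odd_perm t * permprod t A.
  by case: (odd_perm t) => _; rewrite ?mulN1r ?opprK ?mul1r ?subrr //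
    addr_ge0 ?permprod_ge0.
move: per_det; rewrite (psumr_eq0 _ summand_ge0) => /allP/(_ s (mem_index_enum s)) /=.
by rewrite s_odd mulN1r opprK -mulr2n mulrn_eq0 => /eqP.
Qed.

Lemma permanent_eq_permprod1P A : (forall i j, 0 <= A i j) ->
  permanent A = permprod 1%g A <-> (forall s, s != 1%g -> permprod s A = 0).
Proof.
move=> A_ge0; rewrite /permanent (bigD1 1%g) //=; split=> [|off_eq0].
  rewrite -[RHS]addr0 => /addrI/eqP.
  rewrite psumr_eq0 => [/allP off_eq0 s s_neq1|s _]; last exact: permprod_ge0.
  by have /implyP/(_ s_neq1)/eqP := off_eq0 s (mem_index_enum s).
by rewrite big1 ?addr0.
Qed.

Lemma det_eq_permprod1 A :
  (forall s, s != 1%g -> permprod s A = 0) -> \det A = permprod 1%g A.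
Proof.
move=> off_eq0; rewrite /determinant (bigD1 1%g) //= odd_perm1 mul1r [X in _ + X]big1 ?addr0 //.
by move=> s s_neq1; rewrite -/(permprod s A) off_eq0 ?mulr0.
Qed.

Lemma expmx_ge0 A k : (forall i j, 0 <= A i j) -> forall i j, 0 <= (A ^+ k) i j.
Proof.
move=> A_ge0; elim: k => [|k IHk] i j.
  by rewrite expr0 mxE; case: eqP.
by rewrite exprS mxE sumr_ge0 // => l _; rewrite mulr_ge0.
Qed.

Lemma mulmx_neq0 A B i j l : (forall i j, 0 <= A i j) -> (forall i j, 0 <= B i j) ->
  A i l != 0 -> B l j != 0 -> (A *m B) i j != 0.
Proof.
move=> A_ge0 B_ge0 Ail Blj; rewrite mxE psumr_neq0 => [|m _]; last exact: mulr_ge0.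
by apply/hasP; exists l; rewrite ?mem_index_enum // lt0r mulf_neq0 ?mulr_ge0.
Qed.

Lemma expmx_neq0_connect A k i j :
  (A ^+ k) i j != 0 -> connect (fun i j => A i j != 0) i j.
Proof.
elim: k i => [|k IHk] i.
  by rewrite expr0 mxE; have [->|] := eqVneq i j; rewrite ?connect0 ?eqxx.
rewrite exprS mxE => nz.
have [l nzl] : exists l, A i l * (A ^+ k) l j != 0.
  apply/existsP; apply: contraNT nz; rewrite negb_exists => /forallP z.
  by rewrite big1 // => l _; apply/eqP; move: (z l); rewrite negbK.
move: nzl; rewrite mulf_eq0 negb_or => /andP[Ail /IHk]; exact/connect_trans/connect1.
Qed.

End NonnegativePermanent.

Lemma next_notin (T : eqType) (c : seq T) x : x \notin c -> next c x = x.
Proof. by move=> xNc; rewrite next_nth (negPf xNc). Qed.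

(** Two distinct mutually reachable points would give a simple cycle of length at least two.
    Rotating it and fixing all other points, along loops of [e], is a permutation other than the
    identity. *)
Lemma connect_antisym (T : finType) (e : rel T) :
    reflexive e ->
    (forall s : {perm T}, (forall x, e x (s x)) -> s = 1%g) ->
  antisymmetric (connect e).
Proof.
move=> e_refl e_perm x y /andP[/connectP[p0]]; case/shortenP => p.
case: p => [_ _ _ ->//|z p] /= /andP[exz zp] /andP[xNzp _] _ -> {y} conn.
have /connectP[q0] : connect e z x.
  by apply: connect_trans conn; apply/connectP; exists p.
case/shortenP => q zq uq _ x_last.
have cyc : path.cycle e (z :: q) by rewrite /= rcons_path zq -x_last.
pose s := perm (can_inj (prev_next uq)).
have s1 : s = 1%g.
  apply: e_perm => u; rewrite permE.
  have [u_in|u_notin] := boolP (u \in z :: q); first exact: next_cycle cyc u_in.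
  by rewrite next_notin.
suff zx : z = x by rewrite zx mem_head in xNzp.
have <- : next (z :: q) x = x by rewrite -[LHS](permE (can_inj (prev_next uq))) -/s s1 perm1.
(* [x] ends [z :: q], so its successor is looked up just past the end of [q]; the default value [z]
   there is the wrap-around. *)
by rewrite x_last next_nth mem_last index_last //= nth_default.
Qed.

Lemma connect_perm_id (T : finType) (e : rel T) (s : {perm T}) :
  antisymmetric (connect e) -> (forall x, connect e x (s x)) -> s = 1%g.
Proof.
move=> anti es; apply/permP => x; rewrite perm1; apply: anti; rewrite es andbT.
have iter_es k y : connect e y (iter k s y).
  by elim: k => [|k IHk] /=; rewrite ?connect0 // (connect_trans IHk).
(* Injectivity makes orbits closed: iterating [s] from [s x] returns to [x]. *)
have sx_x : fconnect s (s x) x by rewrite fconnect_sym ?fconnect1 //; exact: perm_inj.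
by rewrite -[X in connect e _ X](iter_findex sx_x).
Qed.

Theorem theorem3p7 (R : realType) (n : nat) (A : 'M[R]_n)
    (A_ge0 : forall i j : 'I_n, 0 <= A i j)
    (per_det : permanent A = \det A)
    (A_diag : forall i : 'I_n, A i i != 0) :
  [<-> (* (1) *) forall k : nat, (0 < k)%N -> permanent (A ^+ k) = \det (A ^+ k);
       (* (2) *) permanent (A ^+ 2) = \det (A ^+ 2);
       (* (3) *) permanent A = permprod 1%g A;
       (* (4) *) forall k : nat, (0 < k)%N -> permanent (A ^+ k) = permprod 1%g (A ^+ k)].
Proof.
have expA_ge0 k := expmx_ge0 k A_ge0.
tfae.
- by apply.
- move=> per_det2; apply/permanent_eq_permprod1P => // s s_neq1.
  apply: contraNeq s_neq1 => /permprod_neq0P As; apply/eqP/permP => i.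
  rewrite perm1; apply/eqP; apply: contraT; rewrite eq_sym => i_neq.
  have s_even : ~~ odd_perm s.
    apply/negP => /(permprod_odd_eq0 A_ge0 per_det)/eqP.
    by apply/negP/permprod_neq0P.
  (* The product applies the transposition first: [i] goes to [s (s i)], [s i] stays, and the parity
     of [s] flips. *)
  suff /eqP[] : permprod (tperm i (s i) * s)%g (A ^+ 2) != 0.
    apply: permprod_odd_eq0 => //.
    by rewrite odd_permM odd_tperm i_neq (negPf s_even).
  apply/permprod_neq0P => j; rewrite permM expr2 -mulmxE.
  case: tpermP => [-> | -> | _ _].
  + exact: (@mulmx_neq0 _ _ _ _ _ _ (s i)).
  + exact: (@mulmx_neq0 _ _ _ _ _ _ (s i)).
  + exact: (@mulmx_neq0 _ _ _ _ _ _ j).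
- move=> /(permanent_eq_permprod1P A_ge0) off_eq0 k _.
  apply/permanent_eq_permprod1P => // s; apply: contraNeq => /permprod_neq0P Aks.
  apply/eqP/(@connect_perm_id _ (fun i j => A i j != 0)); last first.
    by move=> i; exact: expmx_neq0_connect (Aks i).
  (* The loops needed for reflexivity are the nonzero diagonal entries [A_diag]. *)
  apply: connect_antisym => // t At; apply/eqP.
  by apply: contraT => /off_eq0/eqP; apply/contraLR => _; apply/permprod_neq0P.
- move=> per_e k k_gt0; rewrite per_e // det_eq_permprod1 //.
  by apply/permanent_eq_permprod1P => //; exact: per_e.
Qed.
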